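(* Let $0<\rho<\gamma<1$ and $\theta=\frac{1-\gamma}{1-\rho}\in(0,1)$. Consider a Markov decision process $(S,A,\mathbb K,q,u,\beta)$ with $r=(1-\beta)u^{1-\rho}$ as described in the context. Let $\omega:S\to[1,\infty)$ be continuous and let $M>0$, $c\ge 1$ be constants such that: (i) for each $s\in S$ the set $A(s)$ is compact, and the correspondence $s\mapsto A(s)$ is upper semicontinuous; (ii) $r(s,a)\le M\omega(s)$ for all $(s,a)\in\mathbb K$; (iii) the function $(s,a)\mapsto\int_S\omega(s')q(ds'|s,a)$ is continuous on $\mathbb K$, $\int_S\omega(s')q(ds'|s,a)\le c\,\omega(s)$ for all $(s,a)\in\mathbb K$, and $c\beta^\theta<1$. For $V\in\mathcal U_+^\omega$ define $$F_1V(s)=\max_{a\in A(s)}\left[r(s,a)+\beta\left(\int_S V(s')q(ds'|s,a)\right)^{1/\theta}\right]^{\theta},\quad s\in S.$$ Then: (a) $F_1$ maps $\mathcal U_+^\omega$ into $\mathcal U_+^\omega$ and is a $c\beta^\theta$-contraction with respect to $\|\cdot\|_\omega$. It has a unique fixed point $w_*\in\mathcal U_+^\omega$. Moreover, for the $n$-th composition $F_1^n$ of $F_1$ with itself and the zero function $\hat 0$, $$\|F_1^n\hat 0-w_*\|_\omega\le\frac{c^n\beta^{n\theta}}{1-c\beta^\theta}M,\qquad n\in\mathbb N.$$ (b) The Bellman equation $$v(s)=\max_{a\in A(s)}H(s,a,v),\quad s\in S,$$ has a unique solution in the class of functions $v:S\to[0,\infty)$ with $v^{1-\gamma}\in\mathcal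 U_+^\omega$, namely $v_*=w_*^{1/(1-\gamma)}$. (c) There exists $f_*\in\Phi$ such that $v_*(s)=H(s,f_*(s),v_* )$ for all $s\in S$. (d) The stationary policy $f_*$ is optimal.
   Context: Model. $S$ (states) and $A$ (actions) are Borel spaces, i.e. Borel subsets of complete separable metric spaces. $\mathbb K\subset S\times A$ is a non-empty Borel set whose sections $A(s)=\{a\in A:(s,a)\in\mathbb K\}$ are non-empty for each $s\in S$. $q$ is a transition probability from $\mathbb K$ to $S$ which is Feller: $(s,a)\mapsto\int_S v(s')q(ds'|s,a)$ is continuous on $\mathbb K$ for every bounded continuous $v:S\to\mathbb R$. $u:\mathbb K\to\mathbb R$ is a non-negative upper semicontinuous per-period utility, $\beta\in[0,1)$ is the discount factor, and $r(s,a)=(1-\beta)u(s,a)^{1-\rho}$. Aggregator. $H(s,a,w)=\left[r(s,a)+\beta\left(\int_S w(s')^{1-\gamma}q(ds'|s,a)\right)^{\frac{1-\rho}{1-\gamma}}\right]^{\frac1{1-\rho}}$ for $(s,a)\in\mathbb K$, whenever the integral exists. Function spaces. For $v:S\to\mathbb R$, $\|v\|_\omega=\sup_{s\in S}|v(s)|/\omega(s)$. $\mathcal U_+^\omega$ is the set of non-negative upper semicontinuous functions on $S$ with finite $\|\cdot\|_\omega$; $\mathcal B_+^\omega$ is the set of non-negative Borel measurable functions on $S$ with finite $\|\cdot\|_\omega$. Contraction. A self-map $F$ of a metric space $(X,d)$ is a $\delta$-contraction if $d(Fx_1,Fx_2)\le\delta d(x_1,x_2)$ for all $x_1,x_2\in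 X$. Correspondences. A correspondence $\varphi$ from $S$ to a separable metric space $Z$ is upper semicontinuous if $\{s\in S:\varphi(s)\cap D\ne\emptyset\}$ is closed for every closed $D\subset Z$. Policies. $\Phi$ is the set of Borel measurable maps $f:S\to A$ with $f(s)\in A(s)$ for all $s$; each $f\in\Phi$ is identified with the stationary policy $(f,f,\ldots)$. For $f\in\Phi$, an $f$-value function is a function $v_f:S\to[0,\infty)$ with $v_f^{1-\gamma}\in\mathcal B_+^\omega$ and $v_f(s)=H(s,f(s),v_f)$ for all $s\in S$. A policy $f_*\in\Phi$ is optimal if $v_{f_*}(s)=\tilde v(s)\ge v_f(s)$ for all $f\in\Phi$ and $s\in S$ (for the $f_*$-value function $v_{f_*}$ and the $f$-value functions $v_f$), where $\tilde v$ is the solution of the Bellman equation (in the class stated in the claim).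
   Formalization: The error bound in (a), false as printed for some M<1 (e.g. one state, θ=1/2, β=9/25, ω=1, c=1, r=M=0.0016, n=1), is proved with M^θ in place of M for all M>0, and with M as printed when M≥1. *)

(* Defs.v *)
From mathcomp Require Export all_boot all_order all_algebra.
From mathcomp Require Export all_classical all_reals all_analysis.
From mathcomp Require Export measurable_realfun.

Set Implicit Arguments.
Unset Strict Implicit.
Unset Printing Implicit Defensive.

Import Order.TTheory GRing.Theory Num.Theory.
Import numFieldNormedType.Exports.

Local Open Scope classical_set_scope.
Local Open Scope ring_scope.

Notation borel T := (g_sigma_algebraType (@open T%type)).

Definition complete_metric (R : realType) (X : metricType R) : Prop :=
  forall F : set_system X, ProperFilter F -> cauchy F -> exists l : X, F --> l.

Definition separable (X : topologicalType) : Prop :=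
  exists2 D : set X, countable D & dense D.

(* [T] is, up to the homeomorphism [e] onto its image, a Borel subset of a
   complete separable metric space with the induced topology. *)
Definition borel_space (R : realType) (T : topologicalType) : Prop :=
  exists (X : metricType R) (e : T -> X),
    [/\ complete_metric X,
        separable X,
        injective e,
        (forall U : set T, open U <-> exists2 V : set X, open V & e @^-1` V = U)
      & <<s @open X >> (range e)].

Definition upper_semicontinuous_on (R : realType) (X : topologicalType)
    (D : set X) (f : X -> R) : Prop :=
  forall x, D x -> forall t, f x < t -> \forall y \near x, D y -> f y < t.

Definition is_max (R : realType) (E : set R) (m : R) : Prop :=
  E m /\ ubound E m.

(* Distances are allowed to be extended real numbers; the one used below is
   finite on the sets of functions under consideration. *)
Definition contraction_on (R : realType) (T : Type) (X : set T)
    (d : T -> T -> \bar R) (delta : R) (F : T -> T) : Prop :=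
  (forall x, X x -> X (F x)) /\
  (forall x1 x2, X x1 -> X x2 -> (d (F x1) (F x2) <= delta%:E * d x1 x2)%E).

Definition correspondence_usc (S Z : topologicalType) (phi : S -> set Z) : Prop :=
  forall D : set Z, closed D -> closed [set s | phi s `&` D !=set0].

Section weighted_norm.
Context (R : realType) (S : ptopologicalType) (omega : S -> R).

Definition wnorm (v : S -> R) : \bar R :=
  ereal_sup (range (fun s => (`|v s| / omega s)%:E)).

Definition wdist (v w : S -> R) : \bar R := wnorm (fun s => v s - w s).

Definition Uplus : set (S -> R) := [set v | [/\ forall s, 0 <= v s,
  upper_semicontinuous_on setT v & (wnorm v < +oo)%E]].

Definition Bplus : set (S -> R) := [set v | [/\ forall s, 0 <= v s,
  measurable_fun [set: borel S] (v : borel S -> R) & (wnorm v < +oo)%E]].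

End weighted_norm.

(* The data living on the set [K] of feasible pairs ([q] and [u]) are
   represented by functions on the whole product [S * A], whose values outside
   [K] are irrelevant: all conditions are relative to [K], and all the operators
   below only evaluate them on [K]. *)
Section mdp.
Context (R : realType) (S A : ptopologicalType).
Context (K : set (S * A)) (q : S * A -> probability (borel S) R).
Context (u : S * A -> R) (beta rho gamma : R) (omega : S -> R).

Definition feasible (s : S) : set A := [set a | K (s, a)].

Definition transition_probability : Prop :=
  forall B : set (borel S), measurable B ->
    measurable_fun (K : set (borel (S * A)%type))
      (fun x : borel (S * A)%type => q x B).

Definition feller : Prop :=
  forall v : S -> R, continuous v -> (exists b : R, forall s, `|v s| <= b) ->
    {within K, continuous (fun x => \int[q x]_s (v s))}.

Definition reward (x : S * A) : R := (1 - beta) * (u x `^ (1 - rho)).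

Definition aggregator (s : S) (a : A) (w : S -> R) : R :=
  (reward (s, a) +
   beta * (\int[q (s, a)]_s' (w s' `^ (1 - gamma)))
            `^ ((1 - rho) / (1 - gamma))) `^ (1 - rho)^-1.

Definition F1_objective (theta : R) (V : S -> R) (s : S) (a : A) : R :=
  (reward (s, a) + beta * (\int[q (s, a)]_s' V s') `^ theta^-1) `^ theta.

(* The maximum is written as a supremum to get a total operator; see [is_max]
   for its attainment. *)
Definition F1 (theta : R) (V : S -> R) (s : S) : R :=
  sup [set F1_objective theta V s a | a in feasible s].

Definition bellman_solution (v : S -> R) : Prop :=
  [/\ forall s, 0 <= v s,
      Uplus omega (fun s => v s `^ (1 - gamma))
    & forall s, is_max [set aggregator s a v | a in feasible s] (v s)].

Definition Phi : set (S -> A) := [set f |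
  measurable_fun [set: borel S] (f : borel S -> borel A) /\
  forall s, feasible s (f s)].

Definition value_function (f : S -> A) (v : S -> R) : Prop :=
  [/\ forall s, 0 <= v s,
      Bplus omega (fun s => v s `^ (1 - gamma))
    & forall s, v s = aggregator s (f s) v].

(* [vt] is meant to be the solution of the Bellman equation. *)
Definition optimal (vt : S -> R) (f : S -> A) : Prop :=
  [/\ Phi f,
      value_function f vt,
      (forall v, value_function f v -> v = vt)
    & forall g v, Phi g -> value_function g v -> forall s, v s <= vt s].

End mdp.

(* Main.v *)
(* In the scale [V = v `^ (1 - gamma)] the Bellman operator is [F1], and it acts
   through the scalar map [x |-> (r + beta * x `^ theta^-1) `^ theta].  Up to
   the factor [beta `^ theta] this is the plane norm of exponent [theta^-1] with
   one coordinate frozen, so by Minkowski's inequality it is Lipschitz with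
   constant [beta `^ theta]; integrating against [q] costs the factor [c] in the
   [omega]-norm.  Semicontinuity is preserved because the Feller property, given
   for bounded continuous functions, passes by infimal convolution to
   [b * omega - V], which is nonnegative and lower semicontinuous.

   The fixed point is the supremum of the increasing sequence [iter n F1 0].
   All comparisons of value functions reduce to one statement: if [V] lies below
   its one-step return and [W] above its one-step return for the same actions,
   then [V <= W], since a bound [V <= W + b * omega] improves to
   [V <= W + kappa ^+ n * b * omega] for every [n], where
   [kappa = c * beta `^ theta].

   An optimal policy is selected measurably from the compact sets of maximizers
   by minimizing successively the distances to the points of a dense sequence:
   the iterated minimizers decrease to a single point. *)

Require Import Defs.
From mathcomp Require Import all_boot all_order all_algebra.
From mathcomp Require Import all_classical all_reals all_analysis.
From mathcomp Require Import measurable_realfun ring lra.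

Import Order.TTheory GRing.Theory Num.Theory.
Import numFieldNormedType.Exports.

Local Open Scope classical_set_scope.
Local Open Scope ring_scope.

Set Implicit Arguments.
Unset Strict Implicit.
Unset Printing Implicit Defensive.

(** * The scalar aggregator *)

(** Convexity: [b + h] and [c] both lie between [b] and [c + h], with complementary weights [t] and
    [1 - t], so adding the two convexity inequalities gives the claim. *)
Lemma powR_increment (R : realType) (p b c h : R) :
  1 <= p -> 0 <= b -> b <= c -> 0 <= h ->
  (b + h) `^ p + c `^ p <= b `^ p + (c + h) `^ p.
Proof.
move=> p1 b0 bc h0; have c0 := le_trans b0 bc.
(* Splitting off [h = 0] keeps the denominator [c + h - b] of the weight positive, even when
   [b = c]. *)
have [->|hN0] := eqVneq h 0; first by rewrite !addr0.
have {hN0}h_gt0 : 0 < h by rewrite lt_neqAle eq_sym hN0.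
have L0 : 0 < c + h - b by lra.
pose t := h / (c + h - b).
have t0 : 0 <= t by rewrite divr_ge0// ltW.
have t1 : t <= 1 by rewrite ler_pdivrMr// mul1r; lra.
have tL : t * (c + h - b) = h by rewrite divfK// gt_eqF.
have ch0 : 0 <= c + h by lra.
have cvx (l : R) : 0 <= l -> l <= 1 ->
    (l * b + (1 - l) * (c + h)) `^ p <= l * b `^ p + (1 - l) * (c + h) `^ p.
  move=> l0 l1; have := @convex_powR R p p1 (Itv01 l0 l1) b (c + h).
  by rewrite !inE/= !in_itv/= !andbT !convRE/= => /(_ b0 ch0).
have bhE : (1 - t) * b + (1 - (1 - t)) * (c + h) = b + h.
  by rewrite -[in RHS]tL; ring.
have cE : t * b + (1 - t) * (c + h) = c.
  by rewrite -[c in RHS](addrK h) -[X in _ = _ - X]tL; ring.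
have := cvx (1 - t); rewrite bhE subr_ge0 gerBl => /(_ t1 t0) h2.
have := cvx t t0 t1; rewrite cE => h1.
lra.
Qed.

Section ces.
Context {R : realType}.
Implicit Types r b x y h th p : R.

(** [F1_objective] unfolds to this when [x] is the integral of [V]; the estimates below thus concern
    real numbers only. *)
Definition ces th b r x : R := (r + b * x `^ th^-1) `^ th.

Lemma ces_ge0 th b r x : 0 <= ces th b r x.
Proof. exact: powR_ge0. Qed.

Lemma powRK x p : 0 <= x -> p != 0 -> (x `^ p) `^ p^-1 = x.
Proof. by move=> x0 p0; rewrite -powRrM divff// powRr1. Qed.

Lemma powRVK x p : 0 <= x -> p != 0 -> (x `^ p^-1) `^ p = x.
Proof. by move=> x0 p0; rewrite -powRrM mulVf// powRr1. Qed.

Lemma powR_le x y p : 0 <= p -> 0 <= x -> x <= y -> x `^ p <= y `^ p.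
Proof.
by move=> p0 x0 xy; apply: ge0_ler_powR => //; rewrite nnegrE// (le_trans x0).
Qed.

Lemma powR_lt_root x t p : 0 < p -> 0 <= x -> 0 <= t ->
  (x `^ p < t) = (x < t `^ p^-1).
Proof.
move=> p0 x0 t0; have pN0 : p != 0 by rewrite gt_eqF.
apply/idP/idP => xt.
  rewrite -[ltLHS](powRK x0 pN0); apply: gt0_ltr_powR => //.
  - by rewrite invr_gt0.
  - by rewrite nnegrE powR_ge0.
rewrite -[ltRHS](powRVK t0 pN0); apply: gt0_ltr_powR => //.
by rewrite nnegrE powR_ge0.
Qed.

Lemma ces_le th b r x y : 0 < th -> 0 <= b -> 0 <= r -> 0 <= x -> x <= y ->
  ces th b r x <= ces th b r y.
Proof.
move=> th0 b0 r0 x0 xy; apply: powR_le; first exact: ltW.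
  by rewrite addr_ge0// mulr_ge0// powR_ge0.
by rewrite lerD2l ler_wpM2l// powR_le// invr_ge0 ltW.
Qed.

(* Minkowski's inequality in the plane, for the exponent [th^-1]. *)
Lemma cesD th b r x h : 0 < th <= 1 -> 0 <= b -> 0 <= r -> 0 <= x -> 0 <= h ->
  ces th b r (x + h) <= ces th b r x + b `^ th * h.
Proof.
move=> /andP[th0 th1] b0 r0 x0 h0; have thN0 : th != 0 by rewrite gt_eqF.
have p0 : 0 <= th^-1 by rewrite invr_ge0 ltW.
have bthp y : 0 <= y -> (b `^ th * y) `^ th^-1 = b * y `^ th^-1.
  by move=> y0; rewrite powRM ?powR_ge0// powRK.
have rb y : 0 <= r + b * y `^ th^-1.
  by rewrite addr_ge0// mulr_ge0// powR_ge0.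
have cp : ces th b r x `^ th^-1 = r + b * x `^ th^-1 by rewrite powRK.
have bc : b `^ th * x <= ces th b r x.
  rewrite -[leLHS](@powRVK _ th) ?mulr_ge0 ?powR_ge0//.
  apply: powR_le; rewrite ?powR_ge0 ?(ltW th0)// bthp//; lra.
have bx0 : 0 <= b `^ th * x by rewrite mulr_ge0 ?powR_ge0.
have bh0 : 0 <= b `^ th * h by rewrite mulr_ge0 ?powR_ge0.
have := @powR_increment R th^-1 (b `^ th * x) (ces th b r x) (b `^ th * h).
rewrite invf_ge1// => /(_ th1 bx0 bc bh0).
rewrite -mulrDr !bthp ?addr_ge0// cp => H.
have {}H : r + b * (x + h) `^ th^-1 <= (ces th b r x + b `^ th * h) `^ th^-1.
  lra.
rewrite -[leRHS](@powRVK _ th)// ?addr_ge0 ?ces_ge0//.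
by apply: powR_le => //; exact: ltW.
Qed.

Lemma ces_le_affine th b r x : 0 < th <= 1 -> 0 <= b -> 0 <= r -> 0 <= x ->
  ces th b r x <= r `^ th + b `^ th * x.
Proof.
move=> th01 b0 r0 x0; have := cesD th01 b0 r0 (lexx 0) x0.
rewrite add0r {2}/ces powR0 ?mulr0 ?addr0//.
by rewrite invr_eq0 gt_eqF//; case/andP: th01.
Qed.

End ces.

(** * Semicontinuity *)

Section upper_semicontinuity.
Context {R : realType} {X : topologicalType}.
Implicit Types (D C : set X) (f g : X -> R).

Lemma usc_on_sub D C f : C `<=` D ->
  upper_semicontinuous_on D f -> upper_semicontinuous_on C f.
Proof.
move=> CD fD x Cx t fxt; apply: filterS (fD x (CD _ Cx) t fxt) => y + /CD.
exact.
Qed.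

Lemma uscD D f g : upper_semicontinuous_on D f -> upper_semicontinuous_on D g ->
  upper_semicontinuous_on D (fun x => f x + g x).
Proof.
move=> uf ug x Dx t fgt; pose e := (t - f x - g x) / 2.
have /(uf x Dx) Uf : f x < f x + e by rewrite /e; lra.
have /(ug x Dx) Ug : g x < g x + e by rewrite /e; lra.
apply: filterS2 Uf Ug => y fy gy Dy.
by have := fy Dy; have := gy Dy; rewrite /e; lra.
Qed.

Lemma uscZ D (k : R) f : 0 <= k -> upper_semicontinuous_on D f ->
  upper_semicontinuous_on D (fun x => k * f x).
Proof.
rewrite le_eqVlt => /predU1P[<-|k0] uf x Dx t.
  by rewrite mul0r => t0; apply: nearW => y _; rewrite mul0r.
rewrite mulrC -ltr_pdivlMr// => /(uf x Dx).
apply: filterS => y /[swap] Dy /(_ Dy) h.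
by rewrite mulrC -ltr_pdivlMr.
Qed.

Lemma usc_powR D f (p : R) : 0 < p -> (forall x, D x -> 0 <= f x) ->
  upper_semicontinuous_on D f -> upper_semicontinuous_on D (fun x => f x `^ p).
Proof.
move=> p0 f0 uf x Dx t fxt.
have t0 : 0 <= t by rewrite (le_trans (powR_ge0 _ _) (ltW fxt)).
move: fxt; rewrite powR_lt_root// ?f0// => /(uf x Dx).
apply: filterS => y /[swap] Dy /(_ Dy) h.
by rewrite powR_lt_root ?f0.
Qed.


End upper_semicontinuity.

Section semicontinuity_topology.
Context {R : realType} {X : topologicalType}.
Implicit Types (D C : set X) (f g : X -> R).

Lemma within_near_lt D f x t : {within D, continuous f} -> D x ->
  f x < t -> \forall y \near x, D y -> f y < t.
Proof.
move=> cf Dx fxt; have : nbhs (f x) [set y | y < t] by exact: lt_nbhsl.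
by move/(cf x); rewrite /nbhs/= -nbhs_subspace_in.
Qed.

Lemma continuous_usc D f :
  {within D, continuous f} -> upper_semicontinuous_on D f.
Proof. by move=> cf x Dx t; exact: within_near_lt. Qed.

(** Weighted uniform limits inherit upper semicontinuity: [V + e * om] is an upper semicontinuous
    majorant of [w], and it exceeds [w] at [x] by at most [2 * e * om x]. *)
Lemma usc_weighted_limit (om w : X -> R) : continuous om ->
  (forall x, 0 <= om x) ->
  (forall e, 0 < e -> exists2 V, upper_semicontinuous_on setT V &
     forall x, V x <= w x + e * om x /\ w x <= V x + e * om x) ->
  upper_semicontinuous_on setT w.
Proof.
(* The added [1] makes the excess [2 * e * om x] strictly smaller than the gap [t - w x]. *)
move=> com om0 wV x _ t wxt; pose e := (t - w x) / (2 * om x + 1).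
have D0 : 0 < 2 * om x + 1 by have := om0 x; lra.
have e0 : 0 < e by rewrite divr_gt0// subr_gt0.
have eE : e * (2 * om x + 1) = t - w x by rewrite divfK// gt_eqF.
have [V uV Vw] := wV e e0.
have uVe : upper_semicontinuous_on setT (fun y => V y + e * om y).
  apply: uscD => //; apply: uscZ; first exact: ltW.
  by apply: continuous_usc; exact: continuous_subspaceT.
have /(uVe x I) : V x + e * om x < t by have [] := Vw x; lra.
apply: filterS => y /(_ I) + _; have [_] := Vw y; lra.
Qed.

(** The superlevel sets at attained values are totally ordered, hence a filter base on [C]. A
    cluster point is a maximizer: were its value below [f a], so would be all values near it,
    against clustering. *)
Lemma usc_max C f : compact C -> C !=set0 -> upper_semicontinuous_on C f ->
  exists2 a, C a & forall b, C b -> f b <= f a.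
Proof.
move=> cC [c0 Cc0] uf.
pose F := filter_from C (fun a => [set b | C b /\ f a <= f b]).
have FF : ProperFilter F.
  apply: filter_from_proper => [|a Ca]; last by exists a.
  apply: filter_from_filter; first by exists c0.
  move=> a b Ca Cb; have [fab|fba] := leP (f a) (f b).
    by exists b => // c [Cc fbc]; do 2 split => //; exact: le_trans fbc.
  by exists a => // c [Cc fac]; do 2 split => //; exact: le_trans (ltW fba) _.
have FC : F C by exists c0 => // b [].
have [p [Cp clFp]] := cC F FF FC; exists p => // a Ca.
rewrite leNgt; apply/negP => /(uf p Cp) fpa.
have [|b [[Cb fab] /(_ Cb)]] := clFp [set b | C b /\ f a <= f b] _ _ fpa.
  by exists a.
by rewrite ltNge fab.
Qed.

Lemma usc_superlevel_compact C f t : compact C ->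
  upper_semicontinuous_on C f -> compact (C `&` [set x | t <= f x]).
Proof.
move=> cC uf F FF FCt.
have [p [Cp clFp]] := cC F FF (filterS (@subIsetl _ _ _) FCt).
exists p; split => //; split => //=.
rewrite leNgt; apply/negP => /(uf p Cp) fpt.
have [y [[Cy ty] /(_ Cy)]] := clFp _ _ FCt fpt.
by rewrite ltNge ty.
Qed.

End semicontinuity_topology.

(** The upper half of the maximum theorem, with actions restricted to [D]. Taking [D = setT] gives
    semicontinuity of the maximum; general [D] serves the measurable selection. *)
Lemma closed_usc_superlevel (R : realType) (S A : topologicalType)
    (phi : S -> set A) (G : S * A -> R) (D : set A) (t : R) :
  (forall s, compact (phi s)) -> correspondence_usc phi ->
  upper_semicontinuous_on [set x | phi x.1 x.2] G -> closed D ->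
  closed [set s | exists a, [/\ phi s a, D a & t <= G (s, a)]].
Proof.
move=> cphi uphi uG cD; rewrite -[X in closed X]setCK; apply: open_closedC.
rewrite openE => s0 /= s0E.
pose P (U : set S) (a : A) := \forall b \near a,
  forall s, U s -> phi s b -> D b -> G (s, b) < t.
(* Each action in [phi s0] has a neighbourhood on which [t] is not reached for states near [s0];
   compactness makes the neighbourhood of [s0] common to all of them. *)
have : \forall U \near powerset_filter_from (nbhs s0), phi s0 `<=` P U.
  apply: (compact_near_coveringP _).1 => // a phia.
  have [Da|nDa] := pselect (D a); last first.
    have ND : nbhs a (~` D).
      by apply: open_nbhs_nbhs; split => //; exact: closed_openC.
    exists (interior (~` D), setT) => /=.
      by split; [exact: nbhs_interior | exact: filterT].
    by move=> [b U]/= [bD _]; apply: filterS bD => c nDc s _ _ /nDc.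
  have Gt : G (s0, a) < t.
    by rewrite ltNge; apply/negP => tG; apply: s0E; exists a.
  have [[U W]/= [nU nW] UW] := uG (s0, a) phia t Gt.
  exists (interior W, [set V | V `<=` U]) => /=.
    split; first exact: nbhs_interior.
    exact: small_set_sub.
  move=> [b V]/= [bW VU]; apply: filterS bW => c Wc s Vs phisc Dc.
  by apply: (UW (s, c)) => //; split => //; exact: VU.
move/near_powerset_filter_fromP => -[U V UV PV a /PV|U nU UP].
  by apply: filterS => b Vb s /UV; exact: Vb.
(* [W] is open and contains [phi s0], so upper semicontinuity of [phi] keeps [phi s] inside [W] for
   [s] near [s0]. *)
pose W := interior [set b | forall s, U s -> phi s b -> D b -> G (s, b) < t].
have nW : \forall s \near s0, ~ ((phi s `&` ~` W) !=set0).
  have := closed_openC (uphi (~` W) (open_closedC (@open_interior _ _))).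
  by rewrite openE; apply => /= -[a [/UP]].
apply: filterS2 nU nW => s Us sW [a [phia Da]]; apply/negP; rewrite -ltNge.
have [|Wa] := pselect (W a); last by case: sW; exists a.
by move/interior_subset; exact.
Qed.

(** * Approximation of lower semicontinuous functions from below by infimal convolution *)

Section moreau_yosida.
Context {R : realType} {X : topologicalType} (d : X -> X -> R) (g : X -> R).
Hypothesis d_ge0 : forall x y, 0 <= d x y.
Hypothesis dxx : forall x, d x x = 0.
Hypothesis d_tri : forall x y z, d x z <= d x y + d y z.
Hypothesis d_near : forall x e, 0 < e ->
  \forall y \near x, d x y < e /\ d y x < e.
Hypothesis near_d : forall x U, nbhs x U ->
  exists2 e, 0 < e & forall y, d x y < e -> U y.
Hypothesis g_ge0 : forall x, 0 <= g x.
Hypothesis g_lsc : forall x t, t < g x -> \forall y \near x, t < g y.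

Let E (n : nat) x := range (fun y => Num.min (g y) n%:R + n%:R * d x y).

(** Truncating [g] at [n] makes the function bounded, and the penalty [n * d] makes it Lipschitz:
    this is the class to which the Feller property applies. *)
Definition moreau_yosida (n : nat) x : R := inf (E n x).

Let E_ge0 n x : lbound (E n x) 0.
Proof.
by move=> _ [y _ <-]; rewrite addr_ge0// ?mulr_ge0// le_min g_ge0/=.
Qed.

Let E_n0 n x : E n x !=set0. Proof. by eexists; exists x. Qed.

Let my_le n x y : moreau_yosida n x <= Num.min (g y) n%:R + n%:R * d x y.
Proof. by apply: ge_inf; [exists 0; exact: E_ge0 | exists y]. Qed.

Lemma moreau_yosida_ge0 n x : 0 <= moreau_yosida n x.
Proof. by apply: lb_le_inf; [exact: E_n0 | exact: E_ge0]. Qed.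

Lemma moreau_yosida_le n x : moreau_yosida n x <= Num.min (g x) n%:R.
Proof. by have := my_le n x x; rewrite dxx mulr0 addr0. Qed.

Let my_lip n x y : moreau_yosida n x <= moreau_yosida n y + n%:R * d x y.
Proof.
rewrite -lerBlDr; apply: lb_le_inf; first exact: E_n0.
move=> _ [z _ <-]; rewrite lerBlDr (le_trans (my_le n x z))//.
by rewrite -addrA lerD2l -mulrDr ler_wpM2l// addrC d_tri.
Qed.

Lemma moreau_yosida_continuous n : continuous (moreau_yosida n).
Proof.
move=> x; apply/cvgrPdist_lt => e e0.
have e1 : 0 < e / n.+1%:R by rewrite divr_gt0.
apply: filterS (d_near x e1) => y [dxy dyx].
have h z : z < e / n.+1%:R -> n%:R * z < e.
  have [z0|z0] := leP z 0.
    by move=> _; rewrite (le_lt_trans _ e0)// mulr_ge0_le0.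
  rewrite ltr_pdivlMr// mulrC; apply: le_lt_trans.
  by rewrite ler_wpM2r ?(ltW z0)// ler_nat.
rewrite ltr_norml; apply/andP; split.
  by have := my_lip n y x; have := h _ dyx; lra.
by have := my_lip n x y; have := h _ dxy; lra.
Qed.

(** For large [n], points [y] with [d x y >= r] pay a penalty of at least [n * r >= g x], while for
    closer points both [g y] and the truncation level [n] exceed [g x - e / 2]. *)
Lemma moreau_yosida_cvg x : moreau_yosida ^~ x @ \oo --> g x.
Proof.
apply/cvgrPdist_lt => e e0.
have /g_lsc/near_d[r r0 rg] : g x - e / 2 < g x by lra.
near=> n.
have gn : g x <= n%:R by near: n; exact: nbhs_infty_ger.
have gnr : g x / r <= n%:R by near: n; exact: nbhs_infty_ger.
have := moreau_yosida_le n x; rewrite le_min => /andP[gx _].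
rewrite ger0_norm ?subr_ge0// ltrBlDr -ltrBlDl.
apply: (@lt_le_trans _ _ (g x - e / 2)); first lra.
apply: lb_le_inf; first exact: E_n0.
move=> _ [y _ <-]; have [dxy|rd] := ltP (d x y) r.
  have := rg _ dxy; have : 0 <= n%:R * d x y by rewrite mulr_ge0.
  by rewrite minEle; case: ifP; lra.
have : g x <= n%:R * d x y.
  apply: (@le_trans _ _ (n%:R * r)); first by rewrite -ler_pdivrMr.
  by rewrite ler_wpM2l.
have : 0 <= Num.min (g y) n%:R by rewrite le_min g_ge0/=.
by lra.
Unshelve. all: by end_near. Qed.

End moreau_yosida.

Lemma borel_space_metric (R : realType) (T : topologicalType) :
  borel_space R T -> exists d : T -> T -> R,
  [/\ forall x y, 0 <= d x y, forall x, d x x = 0,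
      forall x y z, d x z <= d x y + d y z,
      forall x e, 0 < e -> \forall y \near x, d x y < e /\ d y x < e
    & forall x U, nbhs x U -> exists2 e, 0 < e & forall y, d x y < e -> U y].
Proof.
move=> [X [e [_ _ _ eT _]]]; exists (fun x y => mdist (e x) (e y)); split.
- by move=> x y; exact: mdist_ge0.
- by move=> x; exact: mdistxx.
- by move=> x y z; exact: metric_triangle.
- move=> x r r0; have : open (e @^-1` interior (ball (e x) r)).
    by apply/eT; exists (interior (ball (e x) r)) => //; exact: open_interior.
  rewrite openE => /(_ x (nbhs_singleton (nbhs_interior (nbhsx_ballx _ _ r0)))).
  apply: filterS => y /= /interior_subset; rewrite ballEmdist/= => h.
  split => //.
  by rewrite metric_sym.
- move=> x U; rewrite nbhsE => -[V [/eT[W oW <-] /= Wx] VU].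
  move: oW; rewrite openE => /(_ _ Wx); rewrite /interior/= -nbhs_ballE.
  move=> [r /= r0 rW]; exists r => // y dxy; apply/VU/rW.
  by rewrite ballEmdist.
Qed.

Lemma Rintegral_dominated_cvg d (T : measurableType d) (R : realType)
    (mu : {measure set T -> \bar R}) (f_ : nat -> T -> R) (f g : T -> R) :
  (forall n, measurable_fun setT (f_ n)) -> measurable_fun setT f ->
  mu.-integrable setT (EFin \o g) ->
  (forall x, f_ ^~ x @ \oo --> f x) -> (forall n x, `|f_ n x| <= g x) ->
  (fun n => \int[mu]_x f_ n x) @ \oo --> \int[mu]_x f x.
Proof.
move=> mf_ mf ig f_f f_g.
have [|||||intf _ H] := @dominated_convergence _ _ R mu setT measurableT
  (fun n x => (f_ n x)%:E) (EFin \o f) (EFin \o g).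
- by move=> n; exact/measurable_EFinP.
- exact/measurable_EFinP.
- by apply: aeW => x _; apply: cvg_EFin; [exact: nearW|exact: f_f].
- exact: ig.
- by apply: aeW => x n _ /=; rewrite lee_fin.
apply: fine_cvg; rewrite fineK//; exact: integrable_fin_num.
Qed.

(** * Borel measurability from open and closed sets *)

Section borel_measurability.
Context {R : realType} {S : ptopologicalType}.
Implicit Types f g : S -> R.

Lemma open_borel (U : set S) : open U -> measurable (U : set (borel S)).
Proof. exact: sub_sigma_algebra. Qed.

Lemma closed_borel (U : set S) : closed U -> measurable (U : set (borel S)).
Proof.
by move=> /closed_openC/open_borel/measurableC; rewrite setCK.
Qed.

Lemma measurable_borelP d (T : measurableType d) (f : T -> S) :
  (forall D : set S, closed D -> measurable (f @^-1` D)) ->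
  measurable_fun setT (f : T -> borel S).
Proof.
move=> fD; apply: (@measurability _ _ T (borel S) setT f (@open S)) => //.
move=> _ [U oU <-]; rewrite setTI -[X in measurable X]setCK.
by apply: measurableC; apply: (fD (~` U)); exact: open_closedC.
Qed.

Lemma usc_borel f : upper_semicontinuous_on setT f ->
  measurable_fun [set: borel S] (f : borel S -> R).
Proof.
move=> uf; apply: (measurability _ (RGenInftyO.measurableE R)).
move=> /= _ [_ [a ->]] <-; rewrite setTI; apply: open_borel.
rewrite openE => x /=; rewrite in_itv/= => /(uf x I).
by apply: filterS => y /= /(_ I); rewrite in_itv.
Qed.

Lemma continuous_borel f : continuous f ->
  measurable_fun [set: borel S] (f : borel S -> R).
Proof.
move=> cf; apply: usc_borel; apply: continuous_usc.
exact: continuous_subspaceT.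
Qed.

End borel_measurability.

(** * Semicontinuity of integrals of unbounded functions under a Feller kernel *)

Section weighted_Feller.
Context {R : realType} {S : ptopologicalType} {Y : topologicalType}.
Context (K : set Y) (q : Y -> probability (borel S) R) (om : S -> R).
Hypothesis hS : borel_space R S.
Hypothesis om_cont : continuous om.
Hypothesis om_int : forall x, K x -> (q x).-integrable setT (EFin \o om).
Hypothesis om_int_cont : {within K, continuous (fun x => \int[q x]_s om s)}.
Hypothesis q_feller : forall v : S -> R, continuous v ->
  (exists b : R, forall s, `|v s| <= b) ->
  {within K, continuous (fun x => \int[q x]_s (v s))}.

(* [b * om - V] is nonnegative and lower semicontinuous, so it is the increasing
   limit of bounded continuous functions. *)
Lemma usc_Rintegral (V : S -> R) (b : R) : upper_semicontinuous_on setT V ->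
  (forall s, 0 <= V s <= b * om s) ->
  upper_semicontinuous_on K (fun x => \int[q x]_s V s).
Proof.
move=> uV Vb.
have [dist [d0 dxx dtri dnear neard]] := borel_space_metric hS.
pose g s := b * om s - V s.
have mV := usc_borel uV.
have mom := continuous_borel om_cont.
have iom x : K x -> (q x).-integrable setT (EFin \o (fun s => b * om s)).
  by move=> Kx; exact: (integrableZl measurableT b (om_int Kx)).
have iV x : K x -> (q x).-integrable setT (EFin \o V).
  move=> Kx; apply: le_integrable (iom x Kx) => //.
    exact/measurable_EFinP.
  move=> s _ /=; rewrite lee_fin; have /andP[V0 Vbs] := Vb s.
  by rewrite !ger0_norm// (le_trans V0).
have mg : measurable_fun [set: borel S] (g : borel S -> R).
  by apply: measurable_funB => //; exact: measurable_funM.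
have g0 s : 0 <= g s by rewrite subr_ge0; case/andP: (Vb s).
have g_lsc s t : t < g s -> \forall y \near s, t < g y.
  have ug : upper_semicontinuous_on setT (fun s => V s + (- b) * om s).
    apply: uscD => //; apply: continuous_usc; apply: continuous_subspaceT => y.
    by apply: cvgM; [exact: cvg_cst | exact: om_cont].
  move=> tg; have /(ug s I) : V s + - b * om s < - t by rewrite /g in tg; lra.
  by apply: filterS => y /(_ I); rewrite /g; lra.
pose gn := moreau_yosida dist g.
have cgn n : continuous (gn n) by exact: moreau_yosida_continuous.
have [gng gnn] : (forall n s, gn n s <= g s) /\ (forall n s, gn n s <= n%:R).
  suff gn_min n s : gn n s <= Num.min (g s) n%:R.
    by split=> n s; have := gn_min n s; rewrite le_min => /andP[].
  exact: moreau_yosida_le.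
have gn_ge0 n s : 0 <= gn n s by exact: moreau_yosida_ge0.
have ig x : K x -> (q x).-integrable setT (EFin \o g).
  by move=> Kx; apply: (integrableB _ (iom x Kx) (iV x Kx)).
have ign n x : K x -> (q x).-integrable setT (EFin \o gn n).
  move=> Kx; apply: le_integrable (ig x Kx) => //.
    by apply/measurable_EFinP; exact: continuous_borel.
  by move=> s _ /=; rewrite lee_fin !ger0_norm.
have intg x : K x ->
    \int[q x]_s V s = b * \int[q x]_s om s - \int[q x]_s g s.
  move=> Kx; rewrite -RintegralZl//; last exact: om_int.
  rewrite [in X in _ - X]RintegralB//; first by rewrite opprB addrC subrK.
  - exact: iom.
  - exact: iV.
move=> x Kx t Vt; pose e := (t - \int[q x]_s V s) / 3.
have e0 : 0 < e by rewrite divr_gt0// subr_gt0.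
have gn_cvg : (fun n => \int[q x]_s gn n s) @ \oo --> \int[q x]_s g s.
  apply: (@Rintegral_dominated_cvg _ (borel S) R (q x) gn g g) => //.
  - by move=> n; exact: continuous_borel.
  - exact: ig.
  - by move=> s; exact: moreau_yosida_cvg.
  - by move=> n s; by rewrite ger0_norm.
have [n gn_e] : exists n, \int[q x]_s g s - e < \int[q x]_s gn n s.
  move/cvgrPdist_lt : gn_cvg => /(_ e e0)[n _ /(_ n (leqnn n))] /= h.
  by exists n; move: h; rewrite ltr_norml => /andP[_]; lra.
(* Since [gn n <= g = b * om - V], this is a continuous majorant of the integral of [V] on [K]; at
   [x] it is already below [t]. *)
have c1 : {within K, continuous
    (fun y => b * \int[q y]_s om s - \int[q y]_s gn n s)}.
  move=> y; apply: cvgB.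
    by apply: cvgM; [exact: cvg_cst | exact: om_int_cont].
  apply: q_feller => //; exists n%:R => s; by rewrite ger0_norm.
have /(within_near_lt c1 Kx) : b * \int[q x]_s om s - \int[q x]_s gn n s < t.
  by have := intg x Kx; rewrite /e in gn_e; lra.
apply: filterS => y + Ky => /(_ Ky); apply: le_lt_trans.
rewrite intg// lerD2l lerN2; apply: le_Rintegral => //.
- exact: ign.
- exact: ig.
Qed.

End weighted_Feller.

(** * Measurable selection *)

Section measurable_selection.
Context {R : realType} d (T : measurableType d) (A : ptopologicalType).
Hypothesis hA : borel_space R A.

(** The functions [h k] are the distances to a dense sequence: if [a] and [b] have the same ones, a
    dense point within [r / 2] of [a] is also within [r / 2] of [b]. *)
Lemma borel_space_separating : hausdorff_space A /\
  exists h : nat -> A -> R, (forall k, continuous (h k)) /\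
    (forall a b, (forall k, h k a = h k b) -> a = b).
Proof.
have [X [e [_ [D cD dD] einj eA _]]] := hA.
have ce : continuous e.
  by apply/continuousP => U oU; apply/eA; exists U.
have [x xD] : exists x : nat -> X, D `<=` range x.
  have [->|[f]] := pfcard_geP cD; first by exists (fun=> e point).
  by exists f; exact: surj.
split.
  move=> a b ab; apply: einj.
  apply: (@metric_hausdorff _ X) => U V /ce Ua /ce Vb.
  by have [c [? ?]] := ab _ _ Ua Vb; exists (e c).
exists (fun k a => mdist (e a) (x k)); split => [k a|a b hab].
  apply/cvgrPdist_lt => r r0; have : \forall b \near a, ball (e a) r (e b).
    by apply: ce; exact: nbhsx_ballx.
  apply: filterS => b; rewrite ballEmdist/= => ab.
  have := metric_triangle (e a) (e b) (x k).
  have := metric_triangle (e b) (e a) (x k).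
  rewrite (metric_sym (e b) (e a)) => ? ?.
  by rewrite ltr_norml; apply/andP; split; lra.
apply: einj; apply: mdist_positivity; apply/eqP; rewrite eq_le mdist_ge0 andbT.
apply/ler_addgt0Pl => r r0; rewrite addr0.
have r2 : 0 < r / 2 by rewrite divr_gt0.
have [y [ay /xD[k _ xky]]] : interior (ball (e a) (r / 2)) `&` D !=set0.
  apply: dD; last exact: open_interior.
  by exists (e a); exact: (nbhs_singleton (nbhs_interior (nbhsx_ballx _ _ r2))).
have : mdist (e a) (x k) < r / 2.
  by move: ay => /interior_subset; rewrite ballEmdist xky.
have := metric_triangle (e a) (x k) (e b).
rewrite (metric_sym (x k) (e b)) -hab; lra.
Qed.

Variable C : T -> set A.
Hypothesis C_compact : forall s, compact (C s).
Hypothesis C_n0 : forall s, C s !=set0.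
Hypothesis C_hit : forall D : set A, closed D ->
  measurable [set s | C s `&` D !=set0].

Section lexicographic_minimizers.
Variable h : nat -> A -> R.
Hypothesis h_cont : forall k, continuous (h k).

(** Stage [k] has been cut down by [h 0], ..., [h (k - 1)] only; points surviving stage [k.+1] share
    their value of [h k]. *)
Fixpoint lexmin (k : nat) (s : T) : set A :=
  if k is k'.+1 then
    lexmin k' s `&` [set a | forall b, lexmin k' s b -> h k' a <= h k' b]
  else C s.

Let closed_le k t : closed [set a | h k a <= t].
Proof.
rewrite (_ : [set _ | _] = h k @^-1` [set x | x <= t])//.
by apply: closed_comp => [a _|]; [exact: h_cont | exact: closed_le].
Qed.

Lemma lexmin_compact k s : compact (lexmin k s).
Proof.
elim: k => [|k IH]; first exact: C_compact.
apply: compact_closedI => //.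
rewrite (_ : [set _ | _] = \bigcap_(b in lexmin k s) [set a | h k a <= h k b]).
  by apply: closed_bigI => b _; exact: closed_le.
by apply/seteqP; split=> a /=.
Qed.

Lemma lexmin_argmin k s (D : set A) : closed D -> lexmin k s `&` D !=set0 ->
  exists2 a, (lexmin k s `&` D) a &
    forall b, lexmin k s b -> D b -> h k a <= h k b.
Proof.
move=> cD n0; have cC := compact_closedI (@lexmin_compact k s) cD.
have ch : {within lexmin k s `&` D, continuous h k}.
  by apply: continuous_subspaceT; exact: h_cont.
have [a /set_mem aC ah] := compact_EVT_min n0 cC ch.
by exists a => // b Cb Db; apply: ah; rewrite inE.
Qed.

Lemma lexmin_n0 k s : lexmin k s !=set0.
Proof.
elim: k => [|k [a ka]]; first exact: C_n0.
have [|b [kb _] bm] := @lexmin_argmin k s setT closedT; first by exists a.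
by exists b; split => // c kc; exact: bm.
Qed.

(** Some minimizer of [h k] over stage [k] lies in [D] iff the stage meets [D] and every rational
    level reached from above by [h k] on the stage is also reached on its part in [D]. Rational
    levels make the exceptional union countable. *)
Lemma lexmin_hit k (D : set A) : closed D ->
  measurable [set s | lexmin k s `&` D !=set0].
Proof.
elim: k D => [|k IH] D cD; first exact: C_hit.
pose M D := [set s | lexmin k s `&` D !=set0].
pose L (r : rat) := [set a | h k a <= ratr r].
have -> : [set s | lexmin k.+1 s `&` D !=set0] =
    M D `\` \bigcup_(r : rat) (M (L r) `\` M (D `&` L r)).
  apply/seteqP; split => s.
    move=> [a [[ka am] Da]]; split; first by exists a.
    move=> [r _ [[b [kb Lb]]]]; apply; exists a; split => //; split => //.
    by apply: (le_trans (am b kb)).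
  move=> [MD nM]; have [a [ka Da] am] := lexmin_argmin cD MD.
  exists a; split => //; split => // b kb; rewrite leNgt; apply/negP => hba.
  have [r] := rat_in_itvoo hba; rewrite in_itv/= => /andP[br ra].
  apply: nM; exists r => //; split; first by exists b; split => //; exact: ltW.
  move=> [c [kc [Dc Lc]]]; have := am c kc Dc.
  by rewrite leNgt (le_lt_trans Lc ra).
apply: measurableD; first exact: IH.
apply: bigcupT_measurable_rat => r; apply: measurableD; apply: IH.
  exact: closed_le.
by apply: closedI => //; exact: closed_le.
Qed.

Lemma lexmin_sub k n s : lexmin (k + n) s `<=` lexmin k s.
Proof. by elim: n => [|n IH]; rewrite ?addn0// addnS => a [/IH]. Qed.

(** Cantor's intersection theorem for the decreasing stages; the Hausdorff property makes these
    compact sets closed, so a cluster point belongs to all of them. *)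
Lemma lexmin_bigcap s (D : set A) : hausdorff_space A -> closed D ->
  (forall k, lexmin k s `&` D !=set0) ->
  exists2 a, D a & forall k, lexmin k s a.
Proof.
move=> hausA cD kD; pose F := filter_from setT (fun k => lexmin k s `&` D).
have FF : ProperFilter F.
  apply: filter_from_proper => [|k _]; last exact: kD.
  apply: filter_from_filter; first by exists 0%N.
  move=> i j _ _; exists (i + j)%N => // a [ija Da]; do 2 split => //.
    exact: lexmin_sub ija.
  by move: ija; rewrite addnC; exact: lexmin_sub.
have [|a [_ clFa]] := @lexmin_compact 0 s F FF.
  by exists 0%N => // a [].
have clk k : closed (lexmin k s).
  exact: (compact_closed hausA (@lexmin_compact k s)).
have Fk k : F (lexmin k s `&` D) by exists k.
exists a => [|k].
  by apply: cD => U /(clFa _ _ (Fk 0%N))[b [[_ Db] Ub]]; exists b.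
by apply: (clk k) => U /(clFa _ _ (Fk k))[b [[kb _] Ub]]; exists b.
Qed.

End lexicographic_minimizers.

Theorem measurable_selection : exists f : T -> A,
  measurable_fun setT (f : T -> borel A) /\ forall s, C s (f s).
Proof.
have [hausA [h [ch hinj]]] := borel_space_separating.
have /choice[f fk] s : exists a, forall k, lexmin h k s a.
  have [k|a _ ak] := @lexmin_bigcap h ch s setT hausA closedT; last by exists a.
  by have [a ka] := lexmin_n0 ch k s; exists a.
exists f; split; last by move=> s; exact: (fk s 0%N).
have uniq s a : (forall k, lexmin h k s a) -> a = f s.
  move=> ka; apply: hinj => k; apply/eqP; rewrite eq_le.
  have [[fks fm] [aks am]] := (fk s k.+1, ka k.+1).
  by rewrite fm// am.
apply: measurable_borelP => D cD.
(* If every stage meets [D], some point of [D] survives all stages, and by [uniq] that point is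
   [f s]. *)
rewrite (_ : _ @^-1` _ = \bigcap_k [set s | lexmin h k s `&` D !=set0]).
  by apply: bigcapT_measurable => k; exact: lexmin_hit.
apply/seteqP; split => s /=; first by move=> Dfs k _; exists (f s).
move=> sD; have [k|a Da ak] := @lexmin_bigcap h ch s D hausA cD.
  exact: sD.
by rewrite -(uniq s a ak).
Qed.

End measurable_selection.

(** * The Bellman operator *)

Lemma exprn_small (R : realType) (k B e : R) : 0 <= k < 1 -> 0 < e ->
  exists n, B * k ^+ n < e.
Proof.
move=> /andP[k0 k1] e0; have : `|k| < 1 by rewrite ger0_norm.
move=> /(@cvg_geometric R B)/cvgrPdist_lt/(_ e e0)[n _ /(_ n (leqnn n))] /= h.
by exists n; move: h; rewrite sub0r normrN; apply: le_lt_trans; exact: ler_norm.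
Qed.

Section weighted_norm_bounds.
Context {R : realType} {S : ptopologicalType} {om : S -> R}.
Hypothesis om_ge1 : forall s, 1 <= om s.
Implicit Types v w : S -> R.

Let om_gt0 s : 0 < om s. Proof. exact: lt_le_trans ltr01 (om_ge1 s). Qed.

Lemma wnorm_leP v b : (wnorm om v <= b%:E)%E <-> forall s, `|v s| <= b * om s.
Proof.
split=> [vb s|vb].
  rewrite -ler_pdivrMr// -lee_fin; apply: le_trans vb; apply: ereal_sup_ubound.
  by exists s.
by apply: ge_ereal_sup => _ [s _ <-]; rewrite lee_fin ler_pdivrMr.
Qed.

Lemma wnorm_ge0 v : (0 <= wnorm om v)%E.
Proof.
apply: (@le_trans _ _ (`|v point| / om point)%:E).
  by rewrite lee_fin divr_ge0// ltW.
by apply: ereal_sup_ubound; exists point.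
Qed.

Lemma wnorm_ltyP v :
  (wnorm om v < +oo)%E <-> exists2 b, 0 <= b & forall s, `|v s| <= b * om s.
Proof.
split=> [vy|[b b0 /wnorm_leP/le_lt_trans->//]]; last exact: ltry.
have vE : ((fine (wnorm om v))%:E = wnorm om v).
  by rewrite fineK// ge0_fin_numE// wnorm_ge0.
exists (fine (wnorm om v)); first by rewrite fine_ge0// wnorm_ge0.
by apply/wnorm_leP; rewrite vE.
Qed.

End weighted_norm_bounds.

(** * One-step returns, attainment of the maximum and contraction *)

Section dynamic_programming.
Context {R : realType} {S A : ptopologicalType}.
Context (K : set (S * A)) (q : S * A -> probability (borel S) R).
Context (u : S * A -> R) (beta rho theta M c : R) (om : S -> R).
Hypothesis hS : borel_space R S.
Hypothesis KS : forall s, feasible K s !=set0.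
Hypothesis fellerq : feller K q.
Hypothesis u_ge0 : forall x, K x -> 0 <= u x.
Hypothesis usc_u : upper_semicontinuous_on K u.
Hypothesis beta01 : 0 <= beta < 1.
Hypothesis rho_lt1 : rho < 1.
Hypothesis theta01 : 0 < theta <= 1.
Hypothesis om_ge1 : forall s, 1 <= om s.
Hypothesis om_cont : continuous om.
Hypothesis M_gt0 : 0 < M.
Hypothesis c_ge1 : 1 <= c.
Hypothesis compactA : forall s, compact (feasible K s).
Hypothesis uscA : correspondence_usc (feasible K).
Hypothesis r_le : forall x, K x -> reward u beta rho x <= M * om x.1.
Hypothesis om_int_cont : {within K, continuous (fun x => \int[q x]_s om s)}.
Hypothesis om_int_le : forall x, K x ->
  (\int[q x]_s (om s)%:E <= (c * om x.1)%:E)%E.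
Hypothesis c_beta : c * beta `^ theta < 1.

Local Notation r := (reward u beta rho).
Local Notation kappa := (c * beta `^ theta).
Local Notation G V x := (ces theta beta (r x) (\int[q x]_s V s)).
Local Notation T := (F1 K q u beta rho theta).
Implicit Types (V W : S -> R) (x : S * A).

Let om_gt0 s : 0 < om s. Proof. exact: lt_le_trans ltr01 (om_ge1 s). Qed.
Let om_ge0 s : 0 <= om s. Proof. exact: ltW. Qed.
Let beta_ge0 : 0 <= beta. Proof. by case/andP: beta01. Qed.
Let theta_gt0 : 0 < theta. Proof. by case/andP: theta01. Qed.
Let c_ge0 : 0 <= c. Proof. exact: le_trans ler01 c_ge1. Qed.
Let kappa_ge0 : 0 <= kappa. Proof. by rewrite mulr_ge0// powR_ge0. Qed.

Let r_ge0 x : K x -> 0 <= r x.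
Proof.
by move=> Kx; rewrite mulr_ge0 ?powR_ge0// subr_ge0 ltW//; case/andP: beta01.
Qed.

Let m_om : measurable_fun [set: borel S] (om : borel S -> R).
Proof. exact: continuous_borel. Qed.

(** The bound on the extended integral of [om] gives integrability, so that the real-valued
    integrals of functions in [Bplus] are not default values. *)
Let om_integrable x : K x -> (q x).-integrable setT (EFin \o om).
Proof.
move=> Kx; apply/integrableP; split; first exact/measurable_EFinP.
under eq_integral do rewrite /= ger0_norm//.
exact: le_lt_trans (om_int_le Kx) (ltry _).
Qed.

Let Rint_om_le x : K x -> \int[q x]_s om s <= c * om x.1.
Proof.
move=> Kx; rewrite -lee_fin fineK; first exact: om_int_le.
exact: (integrable_fin_num measurableT (om_integrable Kx)).
Qed.

Lemma Bplus_integrable V x : Bplus om V -> K x ->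
  (q x).-integrable setT (EFin \o V).
Proof.
move=> [V0 mV /(wnorm_ltyP om_ge1)[b b0 Vb]] Kx.
apply: le_integrable (integrableZl measurableT b (om_integrable Kx)) => //.
  exact/measurable_EFinP.
by move=> s _; rewrite /= lee_fin [leRHS]ger0_norm// mulr_ge0.
Qed.

Lemma Uplus_Bplus V : Uplus om V -> Bplus om V.
Proof. by move=> [V0 uV Vy]; split=> //; exact: usc_borel. Qed.

Lemma objective_shift V W b x : Bplus om V -> Bplus om W -> 0 <= b ->
  (forall s, V s <= W s + b * om s) -> K x ->
  G V x <= G W x + kappa * b * om x.1.
Proof.
move=> BV BW b0 VW Kx.
have iV := Bplus_integrable BV Kx; have iW := Bplus_integrable BW Kx.
have iom := om_integrable Kx.
have ibom : (q x).-integrable setT (EFin \o (fun s => b * om s)).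
  exact: (integrableZl measurableT b iom).
have [[V0 _ _] [W0 _ _]] := (BV, BW).
have IV : \int[q x]_s V s <= \int[q x]_s W s + b * \int[q x]_s om s.
  rewrite -RintegralZl// -RintegralD//; apply: le_Rintegral => //.
  exact: (integrableD measurableT iW ibom).
have Iom0 : 0 <= \int[q x]_s om s by exact: Rintegral_ge0.
have IV0 : 0 <= \int[q x]_s V s by exact: Rintegral_ge0.
have IW0 : 0 <= \int[q x]_s W s by exact: Rintegral_ge0.
apply: (le_trans (ces_le theta_gt0 beta_ge0 (r_ge0 Kx) IV0 IV)).
have bI0 : 0 <= b * \int[q x]_s om s by exact: mulr_ge0.
apply: (le_trans (cesD theta01 beta_ge0 (r_ge0 Kx) IW0 bI0)).
rewrite lerD2l -(mulrA c) (mulrCA c) -!mulrA ler_wpM2l ?powR_ge0//.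
by rewrite mulrCA ler_wpM2l// Rint_om_le.
Qed.

Lemma objective_bound V b x : Bplus om V -> 0 <= b ->
  (forall s, V s <= b * om s) -> K x ->
  G V x <= (M `^ theta + kappa * b) * om x.1.
Proof.
move=> BV b0 Vb Kx; have [V0 _ _] := BV.
have IV0 : 0 <= \int[q x]_s V s by exact: Rintegral_ge0.
apply: (le_trans (ces_le_affine theta01 beta_ge0 (r_ge0 Kx) IV0)).
rewrite mulrDl; apply: lerD.
  apply: (@le_trans _ _ ((M * om x.1) `^ theta)).
    by apply: powR_le; [exact: ltW | exact: r_ge0 | exact: r_le].
  (* As [om >= 1] and [theta <= 1], [om]^ theta <= om[; the constant keeps its exponent, which is
     the source of]M [^ theta] in the error bound. *)
  rewrite powRM ?(ltW M_gt0)// ler_wpM2l ?powR_ge0//.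
  by apply: ler1_powR => //; case/andP: theta01.
rewrite (mulrC c) -!mulrA ler_wpM2l ?powR_ge0// mulrCA.
apply: (@le_trans _ _ (b * \int[q x]_s om s)); last first.
  by rewrite ler_wpM2l// Rint_om_le.
rewrite -RintegralZl//; last exact: om_integrable.
apply: le_Rintegral => //; first exact: Bplus_integrable.
exact: (integrableZl measurableT b (om_integrable Kx)).
Qed.

Lemma objective_usc V : Uplus om V ->
  upper_semicontinuous_on K (fun x => G V x).
Proof.
move=> [V0 uV /(wnorm_ltyP om_ge1)[b b0 Vb]].
have IV0 x : 0 <= \int[q x]_s V s by exact: Rintegral_ge0.
have uI : upper_semicontinuous_on K (fun x => \int[q x]_s V s).
  apply: (usc_Rintegral hS om_cont om_integrable om_int_cont fellerq uV
    (b := b)).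
  by move=> s; rewrite V0/= (le_trans _ (Vb s))// ler_norm.
apply: usc_powR => //.
  by move=> x Kx; rewrite addr_ge0 ?r_ge0// mulr_ge0// powR_ge0.
apply: uscD.
  apply: uscZ; first by rewrite subr_ge0 ltW//; case/andP: beta01.
  by apply: usc_powR => //; rewrite subr_gt0.
by apply: uscZ => //; apply: usc_powR => //; rewrite invr_gt0.
Qed.

Lemma section_usc V s : Uplus om V ->
  upper_semicontinuous_on (feasible K s) (fun a => G V (s, a)).
Proof.
move=> UV a Ka t /(objective_usc UV Ka) [[U W]/= [nU nW] UW].
apply: filterS nW => b Wb Kb.
by apply: (UW (s, b)) => //; split=> //=; exact: nbhs_singleton.
Qed.

Lemma F1_is_max V s : Uplus om V ->
  is_max [set F1_objective q u beta rho theta V s a | a in feasible K s]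
    (T V s).
Proof.
move=> UV.
have [a Ka am] := usc_max (@compactA s) (KS s) (@section_usc V s UV).
set E := [set _ | _ in _].
have Eub : ubound E (G V (s, a)) by move=> _ [b Kb <-]; exact: am.
have Ea : E (G V (s, a)) by exists a.
suff -> : T V s = G V (s, a) by [].
apply/eqP; rewrite eq_le; apply/andP; split.
  by apply: ge_sup => //; exists (G V (s, a)).
by apply: ub_le_sup => //; exists (G V (s, a)).
Qed.

Lemma F1_attained V s : Uplus om V ->
  exists2 a, K (s, a) & T V s = G V (s, a).
Proof. by move=> /(@F1_is_max _ s)[[a Ka <-] _]; exists a. Qed.

Lemma F1_ge V s a : Uplus om V -> K (s, a) -> G V (s, a) <= T V s.
Proof. by move=> /(@F1_is_max _ s)[_ ub] Ka; apply: ub; exists a. Qed.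

Lemma F1_hit_closed V (D : set A) t : Uplus om V -> closed D ->
  closed [set s | exists a, [/\ feasible K s a, D a & t <= G V (s, a)]].
Proof.
move=> UV cD; apply: (closed_usc_superlevel (G := fun x => G V x)) => //.
rewrite (_ : [set _ | _] = K); first exact: objective_usc.
by apply/seteqP; split=> -[].
Qed.

Lemma F1_Uplus V : Uplus om V -> Uplus om (T V).
Proof.
move=> UV; have BV := Uplus_Bplus UV; split.
- by move=> s; have [a _ ->] := F1_attained s UV; exact: ces_ge0.
- move=> s _ t Tt.
  (* Because the maximum is attained, this closed set is the superlevel set of [T V] at [t]. *)
  have cT := F1_hit_closed (t := t) UV closedT.
  have nsT : ~ exists a, [/\ feasible K s a, [set: A] a & t <= G V (s, a)].
    move=> [a [Ka _]]; apply/negP; rewrite -ltNge.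
    exact: le_lt_trans (F1_ge UV Ka) Tt.
  apply: filterS (open_nbhs_nbhs (conj (closed_openC cT) nsT)) => y /= nE _.
  rewrite ltNge; apply/negP => tT; apply: nE.
  by have [a Ka TE] := F1_attained y UV; exists a; rewrite -TE.
have [V0 _ /(wnorm_ltyP om_ge1)[b b0 Vb]] := BV.
apply/(wnorm_ltyP om_ge1); exists (M `^ theta + kappa * b).
  by rewrite addr_ge0 ?powR_ge0// mulr_ge0.
move=> s; have [a Ka ->] := F1_attained s UV; rewrite ger0_norm ?ces_ge0//.
by apply: (objective_bound BV) => // y; exact: le_trans (ler_norm _) (Vb y).
Qed.

(** A maximizer for [V] is a feasible action for [W]. The case [b = 0] is monotonicity of [T]. *)
Lemma F1_shift V W b : Uplus om V -> Uplus om W -> 0 <= b ->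
  (forall s, V s <= W s + b * om s) ->
  forall s, T V s <= T W s + kappa * b * om s.
Proof.
move=> UV UW b0 VW s; have [a Ka ->] := F1_attained s UV.
apply: (le_trans (objective_shift (Uplus_Bplus UV) (Uplus_Bplus UW) b0 VW Ka)).
by rewrite lerD2r; exact: F1_ge.
Qed.

Lemma wdist_leP V W b : (wdist om V W <= b%:E)%E <->
  forall s, V s <= W s + b * om s /\ W s <= V s + b * om s.
Proof.
rewrite /wdist wnorm_leP//; split => h s; have := h s.
  by rewrite ler_norml => /andP[]; lra.
by move=> []; rewrite ler_norml => ? ?; apply/andP; split; lra.
Qed.

Lemma F1_contraction : contraction_on (Uplus om) (wdist om) kappa T.
Proof.
split; first exact: F1_Uplus.
move=> V W UV UW; have [V0 _ /(wnorm_ltyP om_ge1)[b b0 Vb]] := UV.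
have [W0 _ /(wnorm_ltyP om_ge1)[b' b'0 Wb]] := UW.
(* Finiteness lets the distance itself serve as the real constant in [F1_shift]. *)
have dVW : (wdist om V W < +oo)%E.
  apply/(wnorm_ltyP om_ge1); exists (b + b'); first exact: addr_ge0.
  by move=> s; rewrite mulrDl (le_trans (ler_normB _ _))// lerD.
have dE : (fine (wdist om V W))%:E = wdist om V W.
  by rewrite fineK// ge0_fin_numE// wnorm_ge0.
have d0 : 0 <= fine (wdist om V W) by rewrite fine_ge0// wnorm_ge0.
have : (wdist om V W <= (fine (wdist om V W))%:E)%E by rewrite dE.
move=> /wdist_leP VW; rewrite -dE -EFinM; apply/wdist_leP => s.
by split; apply: F1_shift => // y; have [] := VW y.
Qed.

Let kappa01 : 0 <= kappa < 1. Proof. by rewrite kappa_ge0. Qed.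

(** The functions need only lie in [Bplus] and the action may depend on [s] arbitrarily, so this
    covers both fixed points of [T] and value functions of policies. *)
Lemma Bellman_comparison V W : Bplus om V -> Bplus om W ->
  (forall s, exists a, [/\ K (s, a), V s <= G V (s, a) & G W (s, a) <= W s]) ->
  forall s, V s <= W s.
Proof.
move=> BV BW VW s; have [V0 _ /(wnorm_ltyP om_ge1)[b b0 Vb]] := BV.
have [W0 _ _] := BW; have VWn n s' : V s' <= W s' + b * kappa ^+ n * om s'.
  elim: n s' => [|n IH] s'.
    rewrite expr0 mulr1 (le_trans (ler_norm _))// (le_trans (Vb s'))//.
    by rewrite lerDr.
  have [a [Ka Va Wa]] := VW s'; apply: (le_trans Va).
  have bn0 : 0 <= b * kappa ^+ n by rewrite mulr_ge0// exprn_ge0.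
  apply: (le_trans (objective_shift BV BW bn0 IH Ka)).
  by rewrite exprS (mulrCA b) lerD2r.
rewrite leNgt; apply/negP => WV.
have e0 : 0 < V s - W s by rewrite subr_gt0.
have [n] := exprn_small (b * om s) kappa01 e0.
by have := VWn n s; rewrite mulrAC; lra.
Qed.

(** * Value iteration from zero and its limit *)

Let V_ n := iter n T (fun=> 0).

Lemma iter_F1_Uplus n : Uplus om (V_ n).
Proof.
elim: n => [|n IH]; last exact: F1_Uplus.
split => //=; first by move=> x _ t t0; exact: nearW.
by apply/(wnorm_ltyP om_ge1); exists 0 => // s; rewrite normr0 mul0r.
Qed.

Let V_mono n s : V_ n s <= V_ n.+1 s.
Proof.
elim: n s => [|n IH] s; first by have [] := iter_F1_Uplus 1.
rewrite -[leRHS]addr0 -(mul0r (om s)) -(mulr0 kappa).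
apply: (F1_shift (iter_F1_Uplus n) (iter_F1_Uplus n.+1) (lexx 0)) => s'.
by rewrite mul0r addr0; exact: IH.
Qed.

Let V_step n s : V_ n.+1 s <= V_ n s + M `^ theta * kappa ^+ n * om s.
Proof.
elim: n s => [|n IH] s.
  have [a Ka Ta] := F1_attained s (iter_F1_Uplus 0).
  rewrite -[leLHS]/(T (V_ 0) s) Ta expr0 mulr1 add0r.
  have := @objective_bound (V_ 0) 0 (s, a) (Uplus_Bplus (iter_F1_Uplus 0)).
  by rewrite mulr0 addr0; apply=> // s'; rewrite mul0r.
rewrite exprS (mulrCA _ kappa).
apply: (F1_shift (iter_F1_Uplus n.+1) (iter_F1_Uplus n) _ IH s).
by rewrite mulr_ge0 ?powR_ge0// exprn_ge0.
Qed.

Let kappa_lt1 : 0 < 1 - kappa. Proof. by rewrite subr_gt0. Qed.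

Let B := M `^ theta / (1 - kappa).

Let B_ge0 : 0 <= B. Proof. by rewrite divr_ge0 ?powR_ge0// ltW. Qed.

Let kB_ge0 n : 0 <= kappa ^+ n * B.
Proof. by apply: mulr_ge0 => //; exact: exprn_ge0. Qed.

Let V_tail n k s : V_ (n + k) s <= V_ n s + kappa ^+ n * B * om s.
Proof.
(* The exact partial sum of the geometric series is what the induction on [k] carries through. *)
suff h : V_ (n + k) s <= V_ n s + (kappa ^+ n - kappa ^+ (n + k)) * (B * om s).
  apply: (le_trans h); rewrite lerD2l -[leRHS]mulrA; apply: ler_wpM2r.
    exact: mulr_ge0.
  by rewrite gerBl exprn_ge0.
elim: k => [|k IH]; first by rewrite addn0 subrr mul0r addr0.
rewrite addnS; apply: (le_trans (V_step _ s)).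
have BE : B * (1 - kappa) = M `^ theta by rewrite divfK// gt_eqF.
rewrite -BE exprS; move: IH; lra.
Qed.

Let V_le n m s : (n <= m)%N -> V_ n s <= V_ m s.
Proof.
move=> /subnKC <-; elim: (m - n)%N => [|k IH]; rewrite ?addn0// addnS.
by rewrite (le_trans IH).
Qed.

Definition optimal_value s := sup (range (fun n => V_ n s)).

Let w := optimal_value.

Let w_upper s n :
  ubound (range (fun k => V_ k s)) (V_ n s + kappa ^+ n * B * om s).
Proof.
move=> _ [k _ <-]; have [nk|/ltnW kn] := leqP n k.
  by rewrite -(subnKC nk); exact: V_tail.
by apply: (le_trans (V_le s kn)); rewrite lerDl; exact: mulr_ge0.
Qed.

Let w_le n s : w s <= V_ n s + kappa ^+ n * B * om s.
Proof.
apply: ge_sup; first by exists (V_ 0 s), 0%N.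
exact: w_upper.
Qed.

Let V_le_w n s : V_ n s <= w s.
Proof.
apply: ub_le_sup; last by exists n.
by exists (V_ 0 s + kappa ^+ 0 * B * om s); exact: w_upper.
Qed.

Lemma optimal_value_wdist n :
  (wdist om (V_ n) w <= (kappa ^+ n * B)%:E)%E.
Proof.
apply/wdist_leP => s; split; last exact: w_le.
by apply: (le_trans (V_le_w n s)); rewrite lerDl; exact: mulr_ge0.
Qed.

Lemma optimal_value_Uplus : Uplus om w.
Proof.
have w0 s : 0 <= w s by exact: V_le_w 0%N s.
split => //; last first.
  apply/(wnorm_ltyP om_ge1); exists B => // s; rewrite ger0_norm//.
  by have := w_le 0 s; rewrite expr0 mul1r add0r.
apply: (usc_weighted_limit om_cont om_ge0) => e e0.
have [n nB] := exprn_small B kappa01 e0.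
exists (V_ n) => [|s]; first by have [] := iter_F1_Uplus n.
have nBe : kappa ^+ n * B * om s <= e * om s.
  by rewrite ler_wpM2r// mulrC ltW.
have := w_le n s; have := V_le_w n s.
have : 0 <= e * om s by rewrite mulr_ge0// ltW.
by split; lra.
Qed.

(** Upper bound: [T w] exceeds [V_ n.+1], hence [w], by at most [kappa * (kappa ^+ n * B) * om], for
    every [n]. Lower bound: by monotonicity each [V_ n.+1] is at most [T w]. *)
Lemma optimal_value_fixpoint : T w = w.
Proof.
apply/funext => s; apply/eqP; rewrite eq_le; apply/andP; split.
  apply/ler_addgt0Pl => e e0.
  have [n nB] := exprn_small (B * om s) kappa01 e0.
  have := F1_shift optimal_value_Uplus (iter_F1_Uplus n) (kB_ge0 n) (w_le n) s.
  move=> /le_trans; apply; rewrite addrC.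
  apply: lerD; last exact: V_le_w n.+1 s.
  rewrite -mulrA; apply: (le_trans (ler_piMl _ (ltW c_beta))).
    exact: mulr_ge0.
  by rewrite -mulrA mulrC ltW.
apply: ge_sup; first by exists (V_ 0 s), 0%N.
move=> _ [n _ <-]; apply: (le_trans (V_mono n s)).
rewrite -[leRHS]addr0 -(mul0r (om s)) -(mulr0 kappa).
apply: (F1_shift (iter_F1_Uplus n) optimal_value_Uplus (lexx 0)) => s'.
by rewrite mul0r addr0; exact: V_le_w.
Qed.

Lemma F1_fixpoint_unique V W : Uplus om V -> Uplus om W ->
  T V = V -> T W = W -> V = W.
Proof.
move=> UV UW TV TW; have [BV BW] := (Uplus_Bplus UV, Uplus_Bplus UW).
apply/funext => s; apply/eqP; rewrite eq_le; apply/andP.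
split; apply: Bellman_comparison => // s'.
- have [a Ka Ta] := F1_attained s' UV; exists a; split => //.
    by rewrite -Ta TV.
  by rewrite -[in leRHS]TW; exact: F1_ge.
- have [a Ka Ta] := F1_attained s' UW; exists a; split => //.
    by rewrite -Ta TW.
  by rewrite -[in leRHS]TV; exact: F1_ge.
Qed.

Let w_ge s a : K (s, a) -> G w (s, a) <= w s.
Proof.
move=> Ka; have /= := F1_ge optimal_value_Uplus Ka.
by rewrite (congr1 (@^~ s) optimal_value_fixpoint).
Qed.

Let w_attained s : exists2 a, K (s, a) & w s = G w (s, a).
Proof.
have [a Ka Ta] := F1_attained s optimal_value_Uplus; exists a => //.
by rewrite -Ta (congr1 (@^~ s) optimal_value_fixpoint).
Qed.

(** * Optimal policies *)

Lemma argmax_compact V s t : Uplus om V ->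
  compact [set a | feasible K s a /\ t <= G V (s, a)].
Proof.
by move=> UV; apply: usc_superlevel_compact => //; exact: section_usc.
Qed.

(* A maximizer over [D] attains [w s] iff the maximum over [D] passes every
   rational threshold that the maximum over the whole section passes. *)
Lemma argmax_hit (D : set A) : closed D ->
  measurable [set s : borel S |
    [set a | feasible K s a /\ w s <= G w (s, a)] `&` D !=set0].
Proof.
move=> cD; have Uw := optimal_value_Uplus.
pose L (E : set A) t :=
  [set s | exists a, [/\ feasible K s a, E a & t <= G w (s, a)]].
have mL E t : closed E -> measurable (L E t : set (borel S)).
  by move=> cE; apply: closed_borel; exact: F1_hit_closed.
(* [L D 0] says only that the section meets [D], as the objective is nonnegative. *)
rewrite (_ : [set _ | _] =
    L D 0 `\` \bigcup_(p : rat) (L setT (ratr p) `\` L D (ratr p))); last first.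
  apply/seteqP; split => s.
    move=> [a [[Ka wa] Da]]; split.
      by exists a; split => //; exact: ces_ge0.
    move=> [p _ [[b [Kb _ pb]] nLD]]; apply: nLD; exists a.
    split; [exact: Ka | exact: Da |].
    exact: le_trans pb (le_trans (w_ge Kb) wa).
  move=> [[a0 [Ka0 Da0 _]] nL].
  have [a [Ka Da] am] : exists2 a, (feasible K s `&` D) a &
      forall b, (feasible K s `&` D) b -> G w (s, b) <= G w (s, a).
    apply: usc_max; [exact: compact_closedI | by exists a0 |].
    by apply: usc_on_sub (@section_usc w s Uw) => b [].
  exists a; split; last exact: Da.
  split; first exact: Ka.
  rewrite leNgt; apply/negP => aw.
  have [p] := rat_in_itvoo aw; rewrite in_itv/= => /andP[ap pw].
  apply: nL; exists p; first by []; split.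
    have [b Kb wb] := w_attained s; exists b.
    by split; [exact: Kb | by [] | rewrite -wb; exact: ltW].
  move=> [b [Kb Db pb]]; have := am b (conj Kb Db).
  by rewrite leNgt (lt_le_trans ap pb).
apply: measurableD; first exact: mL.
by apply: bigcupT_measurable_rat => p; apply: measurableD; exact: mL.
Qed.

Lemma measurable_maximizer : borel_space R A ->
  exists2 f, Phi K f & forall s, w s = G w (s, f s).
Proof.
move=> hA; have Uw := optimal_value_Uplus.
have [||f [mf fw]] := measurable_selection hA
    (C := fun s : borel S => [set a | feasible K s a /\ w s <= G w (s, a)]) _ _
    argmax_hit.
- by move=> s; exact: argmax_compact.
- by move=> s; have [a Ka wa] := w_attained s; exists a; rewrite /= -wa.
exists f; first by split => // s; have [] := fw s.
move=> s; have [Kf wf] := fw s; apply/eqP; rewrite eq_le wf/=.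
exact: w_ge.
Qed.

(** * Return from the scale of [F1] to that of the aggregator *)

Section utility_scale.
Variable gamma : R.
Hypothesis gamma_lt1 : gamma < 1.
Implicit Types v : S -> R.
Hypothesis thetaE : theta = (1 - gamma) / (1 - rho).

Local Notation H := (aggregator q u beta rho gamma).
Local Notation up v := (fun s => v s `^ (1 - gamma)).

Let gamma1 : 1 - gamma != 0. Proof. by rewrite gt_eqF// subr_gt0. Qed.

Definition vstar s := w s `^ (1 - gamma)^-1.

Lemma vstar_up : up vstar = w.
Proof.
by apply/funext => s; rewrite powRVK//; have [] := optimal_value_Uplus.
Qed.

(** Exponent arithmetic: [(1 - rho) / (1 - gamma)] is [theta^-1], and [(1 - rho)^-1] is
    [theta / (1 - gamma)]. *)
Lemma aggregator_ces s a v : H s a v = G (up v) (s, a) `^ (1 - gamma)^-1.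
Proof.
by rewrite /aggregator /ces -powRrM thetaE invf_div mulrAC divff ?mul1r.
Qed.

Lemma aggregator_up s a v : H s a v `^ (1 - gamma) = G (up v) (s, a).
Proof. by rewrite aggregator_ces powRVK ?ces_ge0. Qed.

Lemma up_inj v v' : (forall s, 0 <= v s) -> (forall s, 0 <= v' s) ->
  up v = up v' -> v = v'.
Proof.
move=> v0 v'0 vv'; apply/funext => s.
have /= vs := congr1 (fun v => v s `^ (1 - gamma)^-1) vv'.
by rewrite (powRK (v0 s) gamma1) (powRK (v'0 s) gamma1) in vs.
Qed.

Let vstar_ge0 s : 0 <= vstar s. Proof. exact: powR_ge0. Qed.

Lemma vstar_bellman : bellman_solution K q u beta rho gamma om vstar.
Proof.
have Uw := optimal_value_Uplus; split => //; first by rewrite vstar_up.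
have gV : 0 <= (1 - gamma)^-1 by rewrite invr_ge0 subr_ge0 ltW.
move=> s; split.
  have [a Ka wa] := w_attained s; exists a; first exact: Ka.
  by rewrite aggregator_ces vstar_up -wa.
move=> _ [a Ka <-]; rewrite aggregator_ces vstar_up.
by apply: powR_le; [exact: gV | exact: ces_ge0 | exact: w_ge].
Qed.

Lemma bellman_unique v :
  bellman_solution K q u beta rho gamma om v -> v = vstar.
Proof.
move=> [v0 Uv vmax]; apply: up_inj => //; rewrite vstar_up.
apply: F1_fixpoint_unique => //; first exact: optimal_value_Uplus.
  2: exact: optimal_value_fixpoint.
(* It remains to see that the power of [v] is a fixed point of [T]. *)
apply/funext => s; have [[a Ka va] vub] := vmax s.
have g0 : 0 <= 1 - gamma by rewrite subr_ge0 ltW.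
apply/eqP; rewrite eq_le; apply/andP; split.
  have [b Kb ->] := F1_attained s Uv; rewrite -aggregator_up.
  by apply: powR_le; [exact: g0 | exact: powR_ge0 | apply: vub; exists b].
by rewrite -va aggregator_up; exact: F1_ge.
Qed.

Lemma vstar_policy f : (forall s, w s = G w (s, f s)) ->
  forall s, vstar s = H s (f s) vstar.
Proof. by move=> h s; rewrite aggregator_ces vstar_up -h. Qed.

(** Any value function of [f] satisfies the same one-step equation as [w] under the actions of [f],
    so comparison in both directions identifies them. For another policy [g], [w] dominates its
    return under the actions of [g], and one comparison suffices. *)
Lemma vstar_optimal f : Phi K f -> (forall s, vstar s = H s (f s) vstar) ->
  optimal K q u beta rho gamma om vstar f.
Proof.
move=> Pf vf; have Uw := optimal_value_Uplus; have Bw := Uplus_Bplus Uw.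
have wf s : w s = G w (s, f s).
  by rewrite -[in LHS]vstar_up vf aggregator_up vstar_up.
have Kf g s : Phi K g -> K (s, g s) by move=> [_]; exact.
have upE g v : value_function q u beta rho gamma om g v ->
    forall s, v s `^ (1 - gamma) = G (up v) (s, g s).
  by move=> [_ _ ve] s; rewrite [in LHS]ve aggregator_up.
split; first exact: Pf.
- by split; [exact: vstar_ge0 | rewrite vstar_up | exact: vf].
- move=> v vv; have [v0 Bv _] := vv; apply: (up_inj v0 vstar_ge0).
  have vG := upE _ _ vv; rewrite vstar_up.
  apply/funext => s; apply/eqP; rewrite eq_le; apply/andP; split.
    apply: (Bellman_comparison Bv Bw) => s'; exists (f s').
    by split; [exact: Kf | rewrite -vG | rewrite -wf].
  apply: (Bellman_comparison Bw Bv) => s'; exists (f s').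
  by split; [exact: Kf | rewrite -wf | rewrite -vG].
- move=> g v Pg vv s; have [v0 Bv _] := vv.
  rewrite -(powRK (v0 s) gamma1); apply: powR_le.
  + by rewrite invr_ge0 subr_ge0 ltW.
  + exact: powR_ge0.
  apply: (Bellman_comparison Bv Bw) => s'; exists (g s').
  by split; [exact: Kf | rewrite -(upE _ _ vv) | apply: w_ge; exact: Kf].
Qed.

End utility_scale.

End dynamic_programming.

Theorem theorem1 (R : realType) (S A : ptopologicalType)
  (hS : borel_space R S) (hA : borel_space R A)
  (K : set (S * A))
  (K0 : K !=set0)
  (mK : measurable (K : set (borel (S * A)%type)))
  (KS : forall s, feasible K s !=set0)
  (q : S * A -> probability (borel S) R)
  (mq : transition_probability K q)
  (fellerq : feller K q)
  (u : S * A -> R)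
  (u_ge0 : forall x, K x -> 0 <= u x)
  (usc_u : upper_semicontinuous_on K u)
  (beta rho gamma theta : R)
  (beta01 : 0 <= beta < 1)
  (rho_gt0 : 0 < rho) (rho_gamma : rho < gamma) (gamma_lt1 : gamma < 1)
  (thetaE : theta = (1 - gamma) / (1 - rho))
  (omega : S -> R) (omega_ge1 : forall s, 1 <= omega s)
  (omega_cont : continuous omega)
  (M c : R) (M_gt0 : 0 < M) (c_ge1 : 1 <= c)
  (compactA : forall s, compact (feasible K s))
  (uscA : correspondence_usc (feasible K))
  (r_le : forall x, K x -> reward u beta rho x <= M * omega x.1)
  (int_omega_cont : {within K, continuous (fun x => \int[q x]_s omega s)})
  (int_omega_le : forall x, K x ->
    (\int[q x]_s (omega s)%:E <= (c * omega x.1)%:E)%E)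
  (c_beta : c * beta `^ theta < 1) :
  let T := F1 K q u beta rho theta in
  (* (a) *)
  (forall V, Uplus omega V -> forall s,
     is_max [set F1_objective q u beta rho theta V s a | a in feasible K s]
            (T V s)) /\
  contraction_on (Uplus omega) (wdist omega) (c * beta `^ theta) T /\
  exists wstar : S -> R,
    (Uplus omega wstar /\ T wstar = wstar /\
     (forall w, Uplus omega w -> T w = w -> w = wstar)) /\
    (* The bound with constant M fails in general when M < 1. *)
    ((forall n : nat, (wdist omega (iter n T (fun=> 0%R)) wstar <=
        (c ^+ n * beta `^ (n%:R * theta) / (1 - c * beta `^ theta)
           * M `^ theta)%:E)%E) /\
     (1 <= M -> forall n : nat, (wdist omega (iter n T (fun=> 0%R)) wstar <=
        (c ^+ n * beta `^ (n%:R * theta) / (1 - c * beta `^ theta)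
           * M)%:E)%E)) /\
    let vstar := fun s => wstar s `^ (1 - gamma)^-1 in
    (* (b) *)
    (bellman_solution K q u beta rho gamma omega vstar /\
     forall v, bellman_solution K q u beta rho gamma omega v -> v = vstar) /\
    (* (c) *)
    (exists2 f, Phi K f &
       forall s, vstar s = aggregator q u beta rho gamma s (f s) vstar) /\
    (* (d) *)
    (forall f, Phi K f ->
       (forall s, vstar s = aggregator q u beta rho gamma s (f s) vstar) ->
       optimal K q u beta rho gamma omega vstar f).

Proof.
have rho_lt1 : rho < 1 by exact: lt_trans gamma_lt1.
have theta01 : 0 < theta <= 1.
  rewrite thetaE divr_gt0 ?subr_gt0//= ler_pdivrMr ?subr_gt0// mul1r.
  by rewrite lerD2l lerN2 ltW.
move=> T.
pose w := optimal_value K q u beta rho theta.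
have Uw : Uplus omega w by apply: optimal_value_Uplus; eassumption.
have wdist_w n : (wdist omega (iter n T (fun=> 0%R)) w <=
    (c ^+ n * beta `^ (n%:R * theta) / (1 - c * beta `^ theta)
      * M `^ theta)%:E)%E.
  (* The stated constant is [kappa ^+ n * B] with the power of [kappa] distributed over its
     factors. *)
  have -> : c ^+ n * beta `^ (n%:R * theta) / (1 - c * beta `^ theta)
      * M `^ theta =
      (c * beta `^ theta) ^+ n * (M `^ theta / (1 - c * beta `^ theta)).
    rewrite exprMn -(powR_mulrn _ (powR_ge0 beta theta)) -powRrM (mulrC theta).
    by rewrite [RHS]mulrA [RHS]mulrAC.
  by apply: optimal_value_wdist; eassumption.
split; first by move=> V UV s; apply: F1_is_max; eassumption.
split; first by apply: F1_contraction; eassumption.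
exists w; split; [|split; [|split; [|split]]].
- split; first exact: Uw.
  have Tw : T w = w by apply: optimal_value_fixpoint; eassumption.
  split; first exact: Tw.
  by move=> v Uv Tv; apply: F1_fixpoint_unique; eassumption.
- split; first exact: wdist_w.
  move=> M1 n; apply: (le_trans (wdist_w n)); rewrite lee_fin.
  apply: ler_wpM2l; last by apply: ler1_powR => //; case/andP: theta01.
  rewrite mulr_ge0 ?invr_ge0 ?subr_ge0 ?(ltW c_beta)// mulr_ge0 ?powR_ge0//.
  by rewrite exprn_ge0// (le_trans ler01).
- split; first by apply: vstar_bellman; eassumption.
  by move=> v vsol; apply: bellman_unique; eassumption.
- have [f Pf fw] : exists2 f, Phi K f & forall s, w s =
      ces theta beta (reward u beta rho (s, f s)) (\int[q (s, f s)]_s' w s').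
    by apply: measurable_maximizer; eassumption.
  exists f; first exact: Pf.
  by apply: vstar_policy; eassumption.
- by move=> f Pf fw; apply: vstar_optimal; eassumption.
Qed.
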